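(* Let $n\ge 1$ be an integer and let $h_1,h_3$ be the permutations of $\{1,\dots,2n\}$ associated with the Monge shuffles defined in the context. Then $h_1$ and $h_3$ have the same period, and this common period is the smallest integer $u\ge 1$ satisfying one of the two congruences $2^u\equiv 1\pmod{4n+1}$ or $2^u\equiv -1\pmod{4n+1}$.
   Context: The permutations $h_1,h_3$ of $\{1,\dots,2n\}$ are defined by: $h_1(i)=\frac{i+1}{2}+n$ if $i$ is odd, $h_1(i)=n+1-\frac{i}{2}$ if $i$ is even; $h_3(i)=\frac{i}{2}$ if $i$ is even, $h_3(i)=2n-\frac{i-1}{2}$ if $i$ is odd. The period of a permutation $\sigma$ of a finite set is the smallest integer $r\ge 1$ such that $\sigma^r=\mathrm{id}$ ($r$-fold composition). *)

(* Defs.v *)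
From mathcomp Require Import all_boot all_order all_fingroup all_algebra.
From mathcomp Require Import zify.

Set Implicit Arguments.
Unset Strict Implicit.
Unset Printing Implicit Defensive.

(* The set {1, ..., 2n} as a finite subtype of nat, indexed from 1. *)
Definition deck (n : nat) := seq_sub (iota 1 (2 * n)).

(* For 1 <= i <= 2n the quotients are exact and no subtraction truncates. *)
Definition h1_val (n i : nat) : nat :=
  if odd i then (i + 1) %/ 2 + n else n + 1 - i %/ 2.

Definition h3_val (n i : nat) : nat :=
  if odd i then 2 * n - (i - 1) %/ 2 else i %/ 2.

Lemma h1_val_in n (i : deck n) : h1_val n (ssval i) \in iota 1 (2 * n).
Proof.
case: i => i /=; rewrite !mem_iota /h1_val => Hi.
by case: ifP => Hodd; lia.
Qed.

Lemma h3_val_in n (i : deck n) : h3_val n (ssval i) \in iota 1 (2 * n).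
Proof.
case: i => i /=; rewrite !mem_iota /h3_val => Hi.
by case: ifP => Hodd; lia.
Qed.

Definition h1_fun n (i : deck n) : deck n := SeqSub (h1_val_in i).
Definition h3_fun n (i : deck n) : deck n := SeqSub (h3_val_in i).

Lemma h1_fun_inj n : injective (@h1_fun n).
Proof.
move=> [i Hi] [j Hj] /(congr1 (@ssval _ _)) /= E; apply: val_inj => /=.
move: Hi Hj E; rewrite !mem_iota /h1_val => Hi Hj.
by case: ifP => Oi; case: ifP => Oj; lia.
Qed.

Lemma h3_fun_inj n : injective (@h3_fun n).
Proof.
move=> [i Hi] [j Hj] /(congr1 (@ssval _ _)) /= E; apply: val_inj => /=.
move: Hi Hj E; rewrite !mem_iota /h3_val => Hi Hj.
by case: ifP => Oi; case: ifP => Oj; lia.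
Qed.

Definition h1 n : {perm deck n} := perm (@h1_fun_inj n).
Definition h3 n : {perm deck n} := perm (@h3_fun_inj n).

Lemma h1E n (i : deck n) : ssval (h1 n i) = h1_val n (ssval i).
Proof. by rewrite permE. Qed.

Lemma h3E n (i : deck n) : ssval (h3 n i) = h3_val n (ssval i).
Proof. by rewrite permE. Qed.

Definition is_smallest_pos (P : nat -> Prop) (m : nat) : Prop :=
  [/\ 1 <= m, P m & forall k : nat, 1 <= k -> P k -> m <= k].

Definition is_period (T : finType) (s : {perm T}) (r : nat) : Prop :=
  is_smallest_pos (fun k => (s ^+ k)%g = 1%g) r.

(* Main.v *)
(** Modulo [N = 4n+1] the numbers [i] in [1..2n], and likewise the odd numbers
    [2i - 1], represent the nonzero classes up to sign.  In the coordinate [i]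
    for [h3], resp. [2i - 1] for [h1], each shuffle is division by 2 up to sign,
    so its [k]-th power is the identity exactly when [2^k] is [1] or [-1]
    modulo [N]. *)

Require Import Defs.
From mathcomp Require Import all_boot all_order all_fingroup all_algebra.
From mathcomp Require Import cyclic zify ring.


Set Implicit Arguments.
Unset Strict Implicit.
Unset Printing Implicit Defensive.

Import GRing.Theory.

Definition eqz_upto_sign (N a b : int) : Prop :=
  (N %| (a - b)%R)%Z \/ (N %| (a + b)%R)%Z.

Lemma eqz_upto_signM N c a b :
  eqz_upto_sign N a b -> eqz_upto_sign N (c * a)%R (c * b)%R.
Proof.
by case=> H; [left; rewrite -mulrBr | right; rewrite -mulrDr]; rewrite dvdz_mull.
Qed.

Lemma eqz_upto_sign_sym N a b : eqz_upto_sign N a b -> eqz_upto_sign N b a.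
Proof.
by case=> H; [left; rewrite -opprB rpredN | right; rewrite addrC].
Qed.

Lemma eqz_upto_sign_trans N b a c :
  eqz_upto_sign N a b -> eqz_upto_sign N b c -> eqz_upto_sign N a c.
Proof.
case=> H1 [] H2.
- left; have -> : (a - c = (a - b) + (b - c))%R by ring.
  exact: rpredD.
- right; have -> : (a + c = (a - b) + (b + c))%R by ring.
  exact: rpredD.
- right; have -> : (a + c = (a + b) - (b - c))%R by ring.
  exact: rpredB.
- left; have -> : (a - c = (a + b) - (b + c))%R by ring.
  exact: rpredB.
Qed.

Lemma eqz_upto_sign1 N a :
  eqz_upto_sign N a 1 <-> (a = 1 %[mod N])%Z \/ (a = -1 %[mod N])%Z.
Proof.
have dvdD1 : (N %| (a + 1)%R)%Z = (a == -1 %[mod N])%Z.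
  by rewrite eqz_mod_dvd opprK.
rewrite /eqz_upto_sign dvdD1 -eqz_mod_dvd.
by split; case=> /eqP H; [left | right | left | right].
Qed.

Section HalvingPerm.

Variables (T : finType) (s : {perm T}) (N : int) (f : T -> int) (x0 : T).
Hypothesis f_halved : forall x, eqz_upto_sign N (2 * f (s x))%R (f x).
Hypothesis f_sep : forall x y, eqz_upto_sign N (f x) (f y) -> x = y.
Hypothesis f_x0 : f x0 = 1%R.

(** Induction on [k]: the power [s ^+ k.+1] applies [s] first, so the hypothesis at [s x],
    multiplied by 2, chains with one halving step. *)
Lemma expg_halved k x : eqz_upto_sign N (2 ^+ k * f ((s ^+ k)%g x))%R (f x).
Proof.
elim: k x => [|k IHk] x; first by rewrite perm1 mul1r; left; rewrite subrr.
rewrite expgS permM exprS -mulrA.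
exact: eqz_upto_sign_trans (eqz_upto_signM 2 (IHk (s x))) (f_halved x).
Qed.

(** Evaluating at [x0], whose coordinate is 1, gives the direct implication. Conversely, if [2 ^+ k]
    is 1 up to sign, [expg_halved] shows that [s ^+ k] preserves every coordinate up to sign, and
    [f_sep] concludes. *)
Lemma expg_eq1_halving k :
  (s ^+ k)%g = 1%g <-> eqz_upto_sign N (2 ^+ k)%R 1%R.
Proof.
split=> [sk1 | pow2k].
  by have := expg_halved k x0; rewrite sk1 perm1 f_x0 mulr1.
apply/permP => x; rewrite perm1; apply: f_sep.
apply: eqz_upto_sign_trans (expg_halved k x); apply: eqz_upto_sign_sym.
rewrite mulrC -[X in eqz_upto_sign N _ X]mulr1.
exact: eqz_upto_signM.
Qed.

End HalvingPerm.

Lemma h1_expg_eq1 n k : 1 <= n ->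
  (h1 n ^+ k)%g = 1%g <-> eqz_upto_sign (4 * n + 1)%N%:Z (2 ^+ k)%R 1%R.
Proof.
move=> hn; have in1 : 1 \in iota 1 (2 * n) by rewrite mem_iota; lia.
apply: (@expg_eq1_halving _ _ _ (fun i : deck n => (2 * (ssval i)%:Z - 1)%R)
  (SeqSub in1)) => //.
- move=> x; rewrite h1E /h1_val; case: x => i /=; rewrite mem_iota => Hi.
  (* For [i] odd, [2 * f (s x)] is [2i + 4n]; for [i] even it is [4n + 2 - 2i]. Subtracting,
     respectively adding, [2i - 1] gives exactly [4n + 1]. *)
  by case: ifP => Oi; [left | right]; apply/dvdzP; exists 1%R; lia.
- move=> [i Hi] [j Hj] /= E; apply: val_inj => /=.
  move: Hi Hj; rewrite !mem_iota => Hi Hj.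
  (* The difference [2(i - j)] is smaller than [4n + 1] in absolute value, hence 0. The sum
     [2(i + j - 1)] lies strictly between 0 and [2(4n + 1)], and being even it cannot equal
     [4n + 1]. *)
  case: E => /dvdzP[q Hq];
    have [q0|[q1|[q2|qN]]] : (q = 0 \/ q = 1 \/ 2 <= q \/ q <= -1)%R by lia.
  all: by rewrite ?q0 ?q1 in Hq; nia.
Qed.

Lemma h3_expg_eq1 n k : 1 <= n ->
  (h3 n ^+ k)%g = 1%g <-> eqz_upto_sign (4 * n + 1)%N%:Z (2 ^+ k)%R 1%R.
Proof.
move=> hn; have in1 : 1 \in iota 1 (2 * n) by rewrite mem_iota; lia.
apply: (@expg_eq1_halving _ _ _ (fun i : deck n => (ssval i)%:Z%R)
  (SeqSub in1)) => //.
- move=> x; rewrite h3E /h3_val; case: x => i /=; rewrite mem_iota => Hi.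
  by case: ifP => Oi; [right; apply/dvdzP; exists 1%R
                      | left; apply/dvdzP; exists 0%R]; lia.
- move=> [i Hi] [j Hj] /= E; apply: val_inj => /=.
  move: Hi Hj; rewrite !mem_iota => Hi Hj.
  (* Both [|i - j|] and [i + j] are at most [4n], and [i + j] is positive, so only [i - j = 0]
     survives. *)
  case: E => /dvdzP[q Hq];
    have [q0|[q1|[q2|qN]]] : (q = 0 \/ q = 1 \/ 2 <= q \/ q <= -1)%R by lia.
  all: by rewrite ?q0 ?q1 in Hq; nia.
Qed.

Lemma is_period_order (T : finType) (s : {perm T}) : is_period s #[s]%g.
Proof.
split; [exact: order_gt0 | exact: expg_order |].
by move=> k k_gt0 /eqP; rewrite -order_dvdn; apply: dvdn_leq.
Qed.

Lemma eq_is_smallest_pos (P Q : nat -> Prop) m :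
  (forall k, P k <-> Q k) -> is_smallest_pos P m -> is_smallest_pos Q m.
Proof.
by move=> PQ [m_gt0 /PQ Qm m_min]; split=> // k k_gt0 /PQ; apply: m_min.
Qed.

Theorem mainTheorem6 (n : nat) (hn : 1 <= n) :
  exists p : nat,
    [/\ is_period (h1 n) p,
        is_period (h3 n) p
      & is_smallest_pos
          (fun u : nat =>
             ((2%:Z ^+ u)%R = 1 %[mod (4 * n + 1)%N%:Z])%Z \/
             ((2%:Z ^+ u)%R = -1 %[mod (4 * n + 1)%N%:Z])%Z) p].
Proof.
have h1_period := is_period_order (h1 n).
(* The three properties of the exponent [k] are equivalent for each [k], so the least positive
   solution of one is that of all. *)
exists #[h1 n]%g; split=> //; apply: eq_is_smallest_pos h1_period => k.
  by rewrite h1_expg_eq1 // h3_expg_eq1.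
by rewrite h1_expg_eq1 //; apply: eqz_upto_sign1.
Qed.
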